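(* Let $(M,h)$ be a smooth, compact Riemannian surface (without boundary) whose Gauss curvature satisfies $K_h(x)>0$ for all $x\in M$, let $K_0=\inf_{x\in M}K_h(x)$, and let $\bar p_0:M\to\mathbb{R}$ be smooth. If the Ricci flow $$\partial_t\bar p_t=e^{-2\bar p_t}(\Delta_h\bar p_t-K_h)$$ with initial condition $\bar p_0$ has a smooth solution $\bar p_t$ on the time interval $[0,T)$, then for all $t\in[0,T)$ and $x\in M$ $$e^{2\bar p_t(x)}\le e^{2|\bar p_0|_u}-2tK_0.$$ Consequently, the extinction time of the Ricci flow is finite and is at most $e^{2|\bar p_0|_u}/(2K_0)$.
   Context: $\Delta_h$ is the Laplacian of $h$ and $|\cdot|_u$ denotes the uniform (supremum) norm on $M$. The equation is the (unnormalized) Ricci flow $\partial_tg=-2\mathrm{Ric}$ for $g_t=e^{2\bar p_t}h$. The extinction time is the supremum of the times $T$ for which a smooth solution exists on $[0,T)$. *)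

(* Defs.v *)
From HB Require Import structures.
From mathcomp Require Import all_boot all_order all_algebra.
From mathcomp Require Import all_classical all_reals all_analysis.

Set Implicit Arguments.
Unset Strict Implicit.
Unset Printing Implicit Defensive.

Import Order.TTheory GRing.Theory Num.Theory.
Import numFieldNormedType.Exports.

Local Open Scope classical_set_scope.
Local Open Scope ring_scope.

(* [Ck k U f]: f is of class C^k on the open set U.  Only used with V finite-
   dimensional, where "df is C^(k-1)" is the same as "every directional
   derivative of f is C^(k-1)". *)
Fixpoint Ck (R : realType) (V W : normedModType R) (k : nat)
    (U : set V) (f : V -> W) : Prop :=
  match k with
  | 0%N => forall x, U x -> {for x, continuous f}
  | k'.+1 => (forall x, U x -> differentiable f x) /\
             (forall v, Ck k' U (fun x => 'D_v f x))
  end.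

Definition smooth (R : realType) (V W : normedModType R)
    (U : set V) (f : V -> W) : Prop := forall k, Ck k U f.

(* Smoothness on a set A that need not be open: f has, near every point of A,
   a smooth extension to an open neighbourhood of that point. *)
Definition smooth_on (R : realType) (V W : normedModType R)
    (A : set V) (f : V -> W) : Prop :=
  forall a, A a -> exists (U : set V) (F : V -> W),
    [/\ open U, U a, smooth U F & forall z, U z -> A z -> F z = f z].

(* [prm] is the inverse of [crd]; both are total functions whose values are
   meaningless outside [dom] and [cod] respectively. *)
Record chart (R : realType) (M : topologicalType) (n : nat) := Chart {
  dom : set M ;
  cod : set 'rV[R]_n ;
  crd : M -> 'rV[R]_n ;
  prm : 'rV[R]_n -> M ;
  open_dom : open dom ;
  open_cod : open cod ;
  crd_cod : forall x, dom x -> cod (crd x) ;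
  prm_dom : forall y, cod y -> dom (prm y) ;
  crdK : forall x, dom x -> prm (crd x) = x ;
  prmK : forall y, cod y -> crd (prm y) = y ;
  crd_continuous : forall x, dom x -> {for x, continuous crd} ;
  prm_continuous : forall y, cod y -> {for y, continuous prm} }.

Section Transition.
Variables (R : realType) (M : topologicalType) (n : nat).

Definition overlap (c d : chart R M n) : set 'rV[R]_n :=
  [set y | cod c y /\ dom d (prm c y)].

Definition transition (c d : chart R M n) (y : 'rV[R]_n) : 'rV[R]_n :=
  crd d (prm c y).

End Transition.

Record smooth_manifold (R : realType) (n : nat) := SmoothManifold {
  carrier :> topologicalType ;
  manifold_hausdorff : hausdorff_space carrier ;
  manifold_second_countable : @second_countable carrier ;
  atlas : set (chart R carrier n) ;
  atlas_cover : forall x : carrier, exists c, atlas c /\ dom c x ;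
  atlas_compatible : forall c d, atlas c -> atlas d ->
    smooth (overlap c d) (transition c d) }.

Arguments atlas {R n} _.

(* A chart around x, chosen arbitrarily.  The quantities evaluated below in
   this chart (curvature, Laplacian) do not depend on the choice. *)
Definition chart_at (R : realType) (n : nat) (M : smooth_manifold R n) (x : M) :
    chart R M n := projT1 (cid (atlas_cover x)).

Definition smooth_fun (R : realType) (n : nat) (M : smooth_manifold R n)
    (f : M -> R) : Prop :=
  forall c, atlas M c -> smooth (cod c) (fun y => f (prm c y) : R^o).

(* A Riemannian metric as a symmetric (0,2)-tensor field, given by its matrix
   in each chart.  In the row-vector convention of ['J], the differential of
   phi at y sends v to v *m 'J phi y, whence the form of [metric_compatible]. *)
Record riemannian_metric (R : realType) (n : nat) (M : smooth_manifold R n) :=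
  RiemannianMetric {
  metric :> chart R M n -> 'rV[R]_n -> 'M[R]_n ;
  metric_smooth : forall c, atlas M c ->
    forall i j, smooth (cod c) (fun y => metric c y i j : R^o) ;
  metric_sym : forall c y, atlas M c -> cod c y ->
    (metric c y)^T = metric c y ;
  metric_pos : forall c y, atlas M c -> cod c y ->
    forall v : 'rV[R]_n, v != 0 -> 0 < (v *m metric c y *m v^T) 0 0 ;
  metric_compatible : forall c d y, atlas M c -> atlas M d -> overlap c d y ->
    let J := 'J (transition c d) y in
    metric c y = J *m metric d (transition c d y) *m J^T }.

Section LocalGeometry.
Variables (R : realType) (n : nat).

Definition partial (i : 'I_n) (f : 'rV[R]_n -> R) (y : 'rV[R]_n) : R :=
  'D_(delta_mx 0 i) (f : 'rV[R]_n -> R^o) y.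

Variable g : 'rV[R]_n -> 'M[R]_n.

(* Gamma^k_(ij) *)
Definition christoffel (k i j : 'I_n) (y : 'rV[R]_n) : R :=
  2^-1 * \sum_(l < n) invmx (g y) k l *
    (partial i (fun z => g z j l) y + partial j (fun z => g z i l) y
     - partial l (fun z => g z i j) y).

(* the l-th coordinate of R(d_i, d_j) d_k, where
   R(X, Y) Z = nabla_X nabla_Y Z - nabla_Y nabla_X Z - nabla_[X,Y] Z *)
Definition riemann (l k i j : 'I_n) (y : 'rV[R]_n) : R :=
  partial i (christoffel l j k) y - partial j (christoffel l i k) y
  + \sum_(m < n) (christoffel l i m y * christoffel m j k y
                  - christoffel l j m y * christoffel m i k y).

(* trace of the covariant Hessian *)
Definition local_laplacian (f : 'rV[R]_n -> R) (y : 'rV[R]_n) : R :=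
  \sum_(i < n) \sum_(j < n) invmx (g y) i j *
    (partial i (partial j f) y
     - \sum_(k < n) christoffel k i j y * partial k f y).

End LocalGeometry.

(* <R(d_0, d_1) d_1, d_0> / det g *)
Definition local_gauss_curvature (R : realType) (g : 'rV[R]_2 -> 'M[R]_2)
    (y : 'rV[R]_2) : R :=
  (\sum_(l < 2) g y 0 l * riemann g l 1 0 1 y) / \det (g y).

Section Surface.
Variables (R : realType) (M : smooth_manifold R 2) (h : riemannian_metric M).

Definition gauss_curvature (x : M) : R :=
  let c := chart_at x in local_gauss_curvature (h c) (crd c x).

Definition laplacian (f : M -> R) (x : M) : R :=
  let c := chart_at x in
  local_laplacian (h c) (fun y => f (prm c y)) (crd c x).

Definition uniform_norm (f : M -> R) : R := sup [set `|f x| | x in [set: M]].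

(* p is smooth on [0, T[ x M, up to and including t = 0 *)
Definition smooth_evolution (T : \bar R) (p : R -> M -> R) : Prop :=
  forall c, atlas M c ->
    smooth_on [set z : (R^o * 'rV[R]_2)%type |
                0 <= (z.1 : R) /\ ((z.1 : R)%:E < T)%E /\ cod c z.2]
              (fun z => p z.1 (prm c z.2) : R^o).

(* d/dt u = a at time t for a function u on [0, T[: a right derivative when
   t = 0, the usual two-sided derivative when t > 0 *)
Definition has_time_derivative (T : \bar R) (u : R -> R) (t a : R) : Prop :=
  (s - t)^-1 * (u s - u t)
    @[s --> within [set s | 0 <= s /\ (s%:E < T)%E] (t^')] --> a.

Definition ricci_flow (p0 : M -> R) (T : \bar R) (p : R -> M -> R) : Prop :=
  [/\ smooth_evolution T p,
      forall x, p 0 x = p0 x &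
      forall t x, 0 <= t -> (t%:E < T)%E ->
        has_time_derivative T (fun s => p s x) t
          (expR (- (2 * p t x)) * (laplacian (p t) x - gauss_curvature x))].

(* T = 0 always qualifies, as no condition is imposed on an empty interval. *)
Definition extinction_time (p0 : M -> R) : \bar R :=
  ereal_sup [set T : \bar R | (0 <= T)%E /\ exists p, ricci_flow p0 T p].

End Surface.

(* Main.v *)
Require Import Defs.
From mathcomp Require Import all_boot all_order all_algebra.
From mathcomp Require Import all_classical all_reals all_analysis.
From mathcomp Require Import ring lra.

Import Order.TTheory GRing.Theory Num.Theory.
Import numFieldNormedType.Exports.

Local Open Scope classical_set_scope.
Local Open Scope ring_scope.

Set Implicit Arguments.
Unset Strict Implicit.
Unset Printing Implicit Defensive.

(** The upper bound is a maximum principle for [u := expR (2 * p t x)], which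
    satisfies [d/dt u = 2 * (laplacian p - K)].  Where [p t] is maximal on [M]
    the Laplacian is nonpositive, so there [u] decreases at rate at least
    [2 * K0].  To turn this into a proof, let [d > 0] and maximise
    [expR (2 * p s z) + s * (2 * K0 - d)] over the compact product of the time
    interval from 0 to [t] with [M]: at a maximum with [s > 0] the time
    derivative would be at most [- d], while a function whose derivative at [s]
    is negative takes larger values just before [s].  So the maximum is taken at [s = 0], where it is at most
    [expR (2 * uniform_norm p0)]; then let [d] tend to 0.  This is
    [ricci_flow_upper_bound].  If a solution existed beyond
    [expR (2 * uniform_norm p0) / (2 * K0)], the bound at that time would make
    an exponential nonpositive.

    The last step divides by [K0], so it needs [K0 > 0], that is, a positive
    minimum of the curvature on the compact [M].  The difficulty is that
    [gauss_curvature] is read at each point in a chart chosen arbitrarily, so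
    that its continuity is an invariance statement.  Invariance of the
    curvature itself is avoided: a solution up to a time [T > 0] gives, at any
    fixed time [t] strictly between 0 and [T],
    [K = laplacian (p t) - expR (2 * p t) * d/dt p],
    and the right-hand side is continuous as soon as the Laplacian of a smooth
    function is ([gauss_curvature_continuous]).  When no solution exists for a
    positive time the extinction time is 0 and [K0 >= 0] is enough.

    Continuity of the Laplacian follows from its independence of the chart,
    [laplacian_pullback].  This rests on the transformation law of the
    Christoffel symbols ([christoffel_transform]), which makes the covariant
    Hessian a tensor; that law in turn uses that second derivatives of the
    transition maps commute ([schwarz]). *)

(** * Smooth functions *)

Section Smooth.
Context {R : realType}.
Implicit Types V W : normedModType R.

Lemma smooth_continuous V W (U : set V) (f : V -> W) x :
  smooth U f -> U x -> {for x, continuous f}.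
Proof. by move=> fs; exact: (fs 0%N). Qed.

Lemma smooth_differentiable V W (U : set V) (f : V -> W) x :
  smooth U f -> U x -> differentiable f x.
Proof. by move=> fs; exact: (fs 1%N).1. Qed.

Lemma smooth_derive V W (U : set V) (f : V -> W) v :
  smooth U f -> smooth U (fun x => 'D_v f x).
Proof. by move=> fs k; exact: (fs k.+1).2. Qed.

Lemma smooth_derivable V W (U : set V) (f : V -> W) x v :
  smooth U f -> U x -> derivable f x v.
Proof. by move=> fs Ux; apply/diff_derivable/(smooth_differentiable fs). Qed.

(** Differentiability depends on the germ only: the expansion of [f] at [x] is
    also one of [g], and the differential is unique. *)
Lemma near_eq_differentiable V W (f g : V -> W) x :
  (\forall z \near x, f z = g z) -> differentiable f x -> differentiable g x.
Proof.
move=> fg df; have fgx : f x = g x := nbhs_singleton fg.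
have cdf : continuous ('d f x) by exact: diff_continuous.
have E : g \o shift x = cst (g x) + 'd f x +o_ 0 id.
  apply/eqaddoP => e e0.
  have /eqaddoP/(_ _ e0) := diff_locally df.
  have sh : \forall h \near 0, f (h + x) = g (h + x).
    have cs : {for 0, continuous (fun h : V => h + x)}.
      by apply: cvgD; [exact: cvg_id|exact: cvg_cst].
    have : nbhs (0 + x) (fun z => f z = g z) by rewrite add0r.
    exact: cs.
  move: sh; apply: filterS2 => h fgh.
  by rewrite /= !fctE /= fgh fgx.
have dE := diff_unique cdf E.
by apply/diff_locallyP; rewrite dE.
Qed.

Lemma Ck_eq V W k (U : set V) (f g : V -> W) : open U ->
  (forall z, U z -> f z = g z) -> Ck k U f -> Ck k U g.
Proof.
move=> oU; elim: k f g => [|k IH] f g fg /=.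
  move=> cf x Ux; have N : \forall z \near x, f z = g z.
    by have : nbhs x U by [exact: open_nbhs_nbhs]; exact: filterS.
  have cfx : f @ x --> f x := cf x Ux.
  suff : g @ x --> g x by [].
  rewrite -(fg x Ux); apply: cvg_trans cfx.
  by apply: near_eq_cvg; move: N; apply: filterS => z ->.
move=> [df Df]; have N x : U x -> \forall z \near x, f z = g z.
  by move=> Ux; have : nbhs x U by [exact: open_nbhs_nbhs]; exact: filterS.
split => [x Ux|v]; first exact: near_eq_differentiable (N x Ux) (df x Ux).
by apply: IH (Df v) => z Uz; exact: near_eq_derive (N z Uz).
Qed.

Lemma smooth_eq V W (U : set V) (f g : V -> W) : open U ->
  (forall z, U z -> f z = g z) -> smooth U f -> smooth U g.
Proof. by move=> oU fg fs k; exact: Ck_eq oU fg (fs k). Qed.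

Lemma smooth_local V W (U : set V) (f : V -> W) :
  (forall x, U x -> exists2 U' : set V, U' x & smooth U' f) -> smooth U f.
Proof.
move=> fl k.
have {}fl x : U x -> exists2 U' : set V, U' x & Ck k U' f.
  by move=> /fl[U' U'x fs]; exists U'.
elim: k f fl => [|k IH] f fl /=.
  by move=> x /fl[U' U'x]; exact.
split => [x /fl[U' U'x [df _]]|v]; first exact: df.
by apply: IH => x /fl[U' U'x [_ Df]]; exists U' => //; exact: Df.
Qed.

Lemma smooth_sub V W (U U' : set V) (f : V -> W) :
  U `<=` U' -> smooth U' f -> smooth U f.
Proof. by move=> UU' fs; apply: smooth_local => x /UU'; exists U'. Qed.

(** On [U] the derivative of an entry is the entry of the derivative, so the
    induction on the order of differentiability goes through [Ck_eq]. *)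
Lemma smooth_entry V (n : nat) (U : set V) (f : V -> 'rV[R]_n) j : open U ->
  smooth U f -> smooth U (fun z => f z 0 j : R^o).
Proof.
move=> oU fs k; elim: k f fs => [|k IH] f fs /=.
  move=> x Ux; apply: (@continuous_comp _ _ _ f (fun M : 'rV[R]_n => M 0 j)).
    exact: smooth_continuous fs Ux.
  exact: coord_continuous.
split => [x Ux|v].
  apply: (@differentiable_comp _ _ _ _ f (fun M : 'rV[R]_n => M 0 j : R^o)).
    exact: smooth_differentiable fs Ux.
  exact: differentiable_coord.
apply: (@Ck_eq _ _ _ _ (fun z => 'D_v f z 0 j : R^o)) => // [z Uz|].
  by rewrite (derive_mx (smooth_derivable fs Uz)) mxE.
exact/IH/smooth_derive.
Qed.

End Smooth.

(** * Symmetry of second derivatives *)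

Section MixedDerivatives.
Context {R : realType}.
Implicit Types V W : normedModType R.

Lemma derive_translate V W (f : V -> W) (w v x : V) :
  'D_v (fun z => f (z + w)) x = 'D_v f (x + w).
Proof.
rewrite /derive.
suff -> : (fun h : R => h^-1 *: (f (h *: v + x + w) - f (x + w))) =
  (fun h => h^-1 *: (f (h *: v + (x + w)) - f (x + w))) by [].
by apply/funext => h; rewrite addrA.
Qed.

Lemma derivable_translate V W (f : V -> W) (w v x : V) :
  derivable f (x + w) v -> derivable (fun z => f (z + w)) x v.
Proof.
rewrite /derivable => df.
suff -> : (fun h : R => h^-1 *: (f (h *: v + x + w) - f (x + w))) =
  (fun h => h^-1 *: (f (h *: v + (x + w)) - f (x + w))) by [].
by apply/funext => h; rewrite addrA.
Qed.

Lemma is_derive_line V W (f : V -> W) (v y : V) (r : R) :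
  derivable f (r *: v + y) v ->
  is_derive r 1 (fun s : R => f (s *: v + y)) ('D_v f (r *: v + y)).
Proof.
move=> df.
have E : (fun h : R => h^-1 *: ((fun s : R => f (s *: v + y)) (h *: (1 : R) + r) -
    f (r *: v + y))) =
  (fun h => h^-1 *: (f (h *: v + (r *: v + y)) - f (r *: v + y))).
  by apply/funext => h; rewrite addrA -scalerDl [h *: 1]mulr1.
by apply: DeriveDef; rewrite /derivable /derive E.
Qed.

Lemma mvt_line V (f : V -> R^o) (v y : V) (s : R) : 0 < s ->
  (forall r, 0 <= r <= s -> derivable f (r *: v + y) v) ->
  exists2 r, 0 < r < s & f (s *: v + y) - f y = s * 'D_v f (r *: v + y).
Proof.
move=> s0 df.
have dg r : 0 <= r <= s -> is_derive r 1 (fun s : R => f (s *: v + y))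
    ('D_v f (r *: v + y)) by move=> /df; exact: is_derive_line.
have [||r] := @MVT R (fun s : R => f (s *: v + y)) (fun r => 'D_v f (r *: v + y)) 0 s s0.
- move=> x; rewrite in_itv/= => /andP[x0 xs].
  by apply: dg; rewrite !ltW.
- apply: derivable_within_continuous => x; rewrite in_itv/= => xs.
  by have := dg x xs => /@ex_derive.
rewrite in_itv/= => rs; rewrite scale0r add0r subr0 => E; exists r => //.
by rewrite E mulrC.
Qed.

(** The second difference of [f] over the parallelogram spanned by [s *: u] and
    [s *: v] is a second derivative at an interior point: apply the mean value
    theorem in the direction [u] to [z |-> f (z + s *: v) - f z], then in the
    direction [v] to ['D_u f]. *)
Lemma second_difference V (f : V -> R^o) (u v x : V) (s : R) : 0 < s ->
  (forall a b, 0 <= a <= s -> 0 <= b <= s ->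
     derivable f (b *: v + (a *: u + x)) u /\
     derivable (fun z => 'D_u f z) (b *: v + (a *: u + x)) v) ->
  exists a b, [/\ 0 < a < s, 0 < b < s &
    f (s *: v + (s *: u + x)) - f (s *: u + x) - (f (s *: v + x) - f x) =
    s ^+ 2 * 'D_v (fun z => 'D_u f z) (b *: v + (a *: u + x))].
Proof.
move=> s0 df.
have ss : 0 <= s <= s by rewrite lexx ltW.
have s00 : (0 : R) <= 0 <= s by apply/andP; split => //; exact: ltW.
pose g z := f (z + s *: v) - f z.
have dg a : 0 <= a <= s -> is_derive (a *: u + x) u g
    ('D_u f (s *: v + (a *: u + x)) - 'D_u f (a *: u + x)).
  move=> a0.
  have d1 : derivable (fun z => f (z + s *: v)) (a *: u + x) u.
    by apply: derivable_translate; rewrite addrC; exact: (df a s a0 ss).1.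
  have d2 : derivable f (a *: u + x) u.
    by have := (df a 0 a0 s00).1; rewrite scale0r add0r.
  apply: DeriveDef; first exact: derivableB.
  by rewrite (deriveB d1 d2) derive_translate addrC [_ + s *: v]addrC addrC.
have [|a aI Ea] := @mvt_line V g u x s s0.
  by move=> r /dg => /@ex_derive.
have aI' : 0 <= a <= s by case/andP: aI => /ltW -> /ltW ->.
have [|b bI Eb] := @mvt_line V (fun z => 'D_u f z) v (a *: u + x) s s0.
  by move=> r rI; exact: (df a r aI' rI).2.
exists a, b; split => //.
have := @derive_val _ _ _ _ _ _ _ (dg a aI').
rewrite Eb => Dg; move: Ea; rewrite Dg /g.
by rewrite ![_ + s *: v]addrC mulrA expr2.
Qed.

(** The second difference is symmetric in [u] and [v], so
    [second_difference] used in both orders shows that the two mixed derivatives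
    agree at points arbitrarily close to [x]; both are continuous. *)
Lemma schwarz V (U : set V) (f : V -> R^o) (u v x : V) :
  open U -> smooth U f -> U x ->
  'D_v (fun z => 'D_u f z) x = 'D_u (fun z => 'D_v f z) x.
Proof.
move=> oU fs Ux.
have fuv := smooth_derive v (smooth_derive u fs).
have fvu := smooth_derive u (smooth_derive v fs).
apply/eqP; rewrite -subr_eq0 -normr_le0; apply/ler_addgt0Pl => e e0.
rewrite addr0.
have e2 : 0 < e / 2 by rewrite divr_gt0.
have close (a b c : R) : `|a - c| < e / 2 -> `|b - c| < e / 2 -> `|a - b| <= e.
  move=> ac bc; rewrite (le_trans (ler_distD c a b))// (distrC c b).
  by rewrite [leRHS]splitr; apply: lerD; exact: ltW.
have N1 : \forall z \near x,
    `|'D_v (fun z => 'D_u f z) x - 'D_v (fun z => 'D_u f z) z| < e / 2.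
  exact: (proj1 (cvgrPdist_lt _ _) (smooth_continuous fuv Ux) _ e2).
have N2 : \forall z \near x,
    `|'D_u (fun z => 'D_v f z) x - 'D_u (fun z => 'D_v f z) z| < e / 2.
  exact: (proj1 (cvgrPdist_lt _ _) (smooth_continuous fvu Ux) _ e2).
have Nx : \forall z \near x, [/\ U z,
    `|'D_v (fun z => 'D_u f z) x - 'D_v (fun z => 'D_u f z) z| < e / 2 &
    `|'D_u (fun z => 'D_v f z) x - 'D_u (fun z => 'D_v f z) z| < e / 2].
  have N0 : nbhs x U by exact: open_nbhs_nbhs.
  by move: N0 N1 N2; apply: filterS3 => z Uz z1 z2; split.
have cq : {for (0, 0), continuous (fun p : R^o * R^o => p.2 *: v + (p.1 *: u + x))}.
  apply: cvgD; first by apply: cvgZr_tmp; exact: cvg_snd.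
  by apply: cvgD; [apply: cvgZr_tmp; exact: cvg_fst|exact: cvg_cst].
have := cq _ _; rewrite /= !scale0r !add0r => /(_ _ Nx).
case=> -[A B] /= [/nbhs_ballP[d1 /= d10 A1] /nbhs_ballP[d2 /= d20 B2]] ABN.
(* small enough for the parallelogram to stay in the neighbourhood of Nx *)
pose s := Num.min d1 d2 / 2.
have s0 : 0 < s by rewrite divr_gt0// lt_min d10.
have sd1 : s < d1 by rewrite ltr_pdivrMr// gt_min; apply/orP; left; lra.
have sd2 : s < d2 by rewrite ltr_pdivrMr// gt_min; apply/orP; right; lra.
have N a b : 0 <= a <= s -> 0 <= b <= s -> [/\ U (b *: v + (a *: u + x)),
    `|'D_v (fun z => 'D_u f z) x - 'D_v (fun z => 'D_u f z) (b *: v + (a *: u + x))| < e / 2 &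
    `|'D_u (fun z => 'D_v f z) x - 'D_u (fun z => 'D_v f z) (b *: v + (a *: u + x))| < e / 2].
  move=> /andP[a0 as_] /andP[b0 bs]; apply: (ABN (a, b)); split => /=.
    by apply: A1; rewrite /ball/= sub0r normrN ger0_norm// (le_lt_trans as_).
  by apply: B2; rewrite /ball/= sub0r normrN ger0_norm// (le_lt_trans bs).
have [a b aI bI|a1 [b1 [a1s b1s E1]]] := @second_difference V f u v x s s0.
  have [Uab _ _] := N _ _ aI bI; split; first exact: smooth_derivable fs Uab.
  exact: smooth_derivable (smooth_derive u fs) Uab.
have [a b aI bI|a2 [b2 [a2s b2s E2]]] := @second_difference V f v u x s s0.
  have [Uab _ _] := N _ _ bI aI; rewrite addrCA in Uab; split.
    exact: smooth_derivable fs Uab.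
  exact: smooth_derivable (smooth_derive v fs) Uab.
move: E2; rewrite [b2 *: u + _]addrCA.
set P2 := a2 *: v + _ => E2.
move: E1; set P1 := b1 *: v + _ => E1.
have W c : 0 < c < s -> 0 <= c <= s by move=> /andP[/ltW -> /ltW ->].
have [_ H1 _] := N _ _ (W _ a1s) (W _ b1s).
have [_ _ H2] := N _ _ (W _ b2s) (W _ a2s).
have PP : 'D_v (fun z => 'D_u f z) P1 = 'D_u (fun z => 'D_v f z) P2.
  have s2 : s ^+ 2 != 0 by rewrite expf_neq0// gt_eqF.
  have alg (a b c d : R) : a - b - (c - d) = a - c - (b - d) by ring.
  have E3 : f (s *: u + (s *: v + x)) = f (s *: v + (s *: u + x)) by rewrite addrCA.
  rewrite E3 in E2.
  apply: (mulfI s2); exact: etrans (esym E1) (etrans (alg _ _ _ _) E2).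
rewrite -/P1 PP in H1; rewrite -/P2 in H2.
exact: close _ _ _ H1 H2.
Qed.

End MixedDerivatives.

(** * Maxima, chain rule and slices *)

Section Maximum.
Context {R : realType} {V : normedModType R}.

Lemma near_line (U : set V) (v x : V) : open U -> U x ->
  exists2 d : R, 0 < d & forall r, `|r| < d -> U (r *: v + x).
Proof.
move=> oU Ux.
have cl : {for 0, continuous (fun r : R^o => r *: v + x)}.
  by apply: cvgD; [exact: cvgZr_tmp|exact: cvg_cst].
have /cl : nbhs (0 *: v + x) U by rewrite scale0r add0r; exact: open_nbhs_nbhs.
move=> /nbhs_ballP[d /= d0 dU]; exists d => // r rd.
by apply: dU; rewrite /ball/= sub0r normrN.
Qed.

Lemma derive_at_max (U : set V) (f : V -> R^o) (v x : V) :
  open U -> smooth U f -> U x -> (forall z, U z -> f z <= f x) ->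
  'D_v f x = 0.
Proof.
move=> oU fs Ux fmax.
have [d d0 dU] := near_line v oU Ux.
have dU' t : t \in `]- d, d[%R -> U (t *: v + x).
  by rewrite in_itv/= => td; apply: dU; rewrite ltr_norml.
have d00 : 0 \in `]- d, d[%R by rewrite in_itv/= oppr_lt0 d0.
have dg r : U (r *: v + x) ->
    is_derive r 1 (fun r : R => f (r *: v + x)) ('D_v f (r *: v + x)).
  by move=> Ur; apply: is_derive_line; exact: smooth_derivable fs Ur.
have U0 : U (0 *: v + x) by rewrite scale0r add0r.
have := @derive_val _ _ _ _ _ _ _ (dg 0 U0).
rewrite scale0r add0r => <-; apply: derive_val.
apply: (derive1_at_max _ _ d00).
- by rewrite ge0_cp// ltW.
- by move=> t /dU'/dg/@ex_derive.
- by move=> t /dU' Ut; rewrite scale0r add0r; exact: fmax.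
Qed.

(** If the second derivative were positive, then the first one, which vanishes
    at [x], would be positive shortly after [x] on the line directed by [v], and
    [f] would increase along that line. *)
Lemma second_derive_at_max (U : set V) (f : V -> R^o) (v x : V) :
  open U -> smooth U f -> U x -> (forall z, U z -> f z <= f x) ->
  'D_v (fun z => 'D_v f z) x <= 0.
Proof.
move=> oU fs Ux fmax; rewrite leNgt; apply/negP => a0.
have [d d0 dU] := near_line v oU Ux.
have /cvgrPdist_lt/(_ _ a0) := smooth_derivable (v := v) (smooth_derive v fs) Ux.
rewrite -/(derive _ _ _) (derive_at_max v oU fs Ux fmax).
move=> /nbhs_ballP[e /= e0 eD].
pose s := Num.min d e / 2.
have s0 : 0 < s by rewrite divr_gt0// lt_min d0.
have sd : s < d by rewrite ltr_pdivrMr// gt_min; apply/orP; left; lra.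
have se : s < e by rewrite ltr_pdivrMr// gt_min; apply/orP; right; lra.
have Us r : 0 <= r <= s -> U (r *: v + x).
  by move=> /andP[r0 rs]; apply: dU; rewrite ger0_norm// (le_lt_trans rs).
have [|r /andP[r0 rs]] := @mvt_line R V f v x s s0.
  by move=> r /Us Ur; exact: (smooth_derivable (W := R^o) fs).
move=> E.
have Dr : 0 < 'D_v f (r *: v + x).
  have := eD r; rewrite /ball/= sub0r normrN gtr0_norm// => /(_ (lt_trans rs se)).
  move=> /(_ (lt0r_neq0 r0)); rewrite subr0 => /(le_lt_trans (ler_norm _)).
  by rewrite ltrBlDl ltrDr pmulr_rgt0// invr_gt0.
have : f (s *: v + x) <= f x by apply/fmax/Us; rewrite lexx ltW.
by rewrite -subr_le0 E leNgt mulr_gt0.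
Qed.

End Maximum.

Section Chain.
Context {R : realType}.

Lemma derive_chain (V W X : normedModType R) (f : W -> X) (phi : V -> W) (v y : V) :
  differentiable phi y -> differentiable f (phi y) ->
  'D_v (f \o phi) y = 'D_('D_v phi y) f (phi y).
Proof.
move=> dphi df; rewrite !deriveE//; last exact: differentiable_comp.
by rewrite diff_comp.
Qed.

Lemma derive_rV (n : nat) (W : normedModType R) (f : 'rV[R]_n -> W) (v y : 'rV[R]_n) :
  differentiable f y ->
  'D_v f y = \sum_(i < n) v 0 i *: 'D_(delta_mx 0 i) f y.
Proof.
move=> df; rewrite deriveE// {1}[v]row_sum_delta linear_sum.
by apply: eq_bigr => i _; rewrite linearZ deriveE.
Qed.

Lemma derive_pair_fst (V W X : normedModType R) (F : V * W -> X) (v a : V) (b : W) :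
  'D_v (fun z => F (z, b)) a = 'D_((v, 0) : V * W) F (a, b).
Proof.
rewrite /derive.
suff -> : (fun h : R => h^-1 *: (F (h *: v + a, b) - F (a, b))) =
  (fun h => h^-1 *: (F (h *: ((v, 0) : V * W) + (a, b)) - F (a, b))) by [].
apply/funext => h; congr (_ *: (F _ - _)).
by congr pair; rewrite /= scaler0 add0r.
Qed.

Lemma derive_pair_snd (V W X : normedModType R) (F : V * W -> X) (v b : W) (a : V) :
  'D_v (fun z => F (a, z)) b = 'D_((0, v) : V * W) F (a, b).
Proof.
rewrite /derive.
suff -> : (fun h : R => h^-1 *: (F (a, h *: v + b) - F (a, b))) =
  (fun h => h^-1 *: (F (h *: ((0, v) : V * W) + (a, b)) - F (a, b))) by [].
apply/funext => h; congr (_ *: (F _ - _)).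
by congr pair; rewrite /= scaler0 add0r.
Qed.

Lemma smooth_slice (V W : normedModType R) (U : set (R^o * V)%type) (s : R)
    (F : R^o * V -> W) :
  smooth U F -> smooth [set z | U (s, z)] (fun z => F (s, z)).
Proof.
have dpair z : differentiable (fun z : V => (s, z) : R^o * V) z.
  by apply: differentiable_pair; [exact: differentiable_cst|exact: ex_diff].
move=> Fs k; elim: k F Fs => [|k IH] F Fs /=.
  move=> z Uz; apply: (@continuous_comp _ _ _ (fun z : V => (s, z) : R^o * V) F).
    exact: differentiable_continuous.
  exact: smooth_continuous Fs Uz.
split => [z Uz|v].
  apply: (@differentiable_comp _ _ _ _ (fun z : V => (s, z) : R^o * V) F) => //.
  exact: smooth_differentiable Fs Uz.
rewrite (_ : (fun z => _) = fun z => 'D_((0, v) : R^o * V) F (s, z)); last first.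
  by apply/funext => z; exact: derive_pair_snd.
apply: (IH (fun w => 'D_((0, v) : R^o * V) F w)); exact: smooth_derive.
Qed.

End Chain.

(** * Transformation of Christoffel symbols and covariant Hessians *)

Section TensorAlgebra.
Context {R : realType} {n : nat}.
Implicit Types (G J H : 'M[R]_n) (D Q : 'I_n -> 'M[R]_n).

(** The Christoffel symbols as a function of the values at one point of the
    metric and of its partial derivatives, [D l] standing for the derivative in
    the direction [l]; see [christoffelE]. *)
Definition christoffel_of G D (k i j : 'I_n) : R :=
  2^-1 * \sum_(l < n) invmx G k l * (D i j l + D j i l - D l i j).

Lemma invmx_congruence J G : J \in unitmx -> G \in unitmx ->
  J^T *m invmx (J *m G *m J^T) *m J = invmx G.
Proof.
move=> Ju Gu; have JTu : J^T \in unitmx by rewrite unitmx_tr.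
have Hu : J *m G *m J^T \in unitmx by rewrite !unitmx_mul Ju Gu.
apply: (can_inj (mulmxK Gu)); rewrite mulVmx//.
apply: (can_inj (mulmxK JTu)); rewrite mul1mx -!mulmxA.
by rewrite (mulmxA J) mulVmx// mulmx1.
Qed.

Lemma trilinear_sum J (f : 'I_n -> 'I_n -> 'I_n -> R) (i j l : 'I_n) :
  \sum_e J l e * (\sum_b \sum_c J i b * J j c * f b c e) =
  \sum_b \sum_c \sum_e J i b * J j c * J l e * f b c e.
Proof.
under eq_bigr do rewrite mulr_sumr.
rewrite exchange_big; apply: eq_bigr => b _.
under eq_bigr do rewrite mulr_sumr.
rewrite exchange_big; apply: eq_bigr => c _.
by apply: eq_bigr => e _; ring.
Qed.

Lemma congruence_entry (m : nat) (J : 'M[R]_(m, n)) H (i j : 'I_m) :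
  (J *m H *m J^T) i j = \sum_b \sum_c J i b * J j c * H b c.
Proof.
rewrite mxE exchange_big/=; apply: eq_bigr => c _; rewrite !mxE mulr_suml.
by apply: eq_bigr => b _; ring.
Qed.

(** The law
    [Gamma^k_ij J_ka = d_i J_ja + J_ib J_jc Gamma'^a_bc]
    with [Q i] for the derivative of the Jacobian [J] in the direction [i].  The
    six terms in [Q] coming from the three derivatives of the metric
    [J G J^T] reduce to twice one of them because [Q] and [G] are symmetric;
    the remaining terms are tensorial, and [invmx_congruence] removes the
    inverse of the metric. *)
Lemma christoffel_transform J G Q D0 D :
  J \in unitmx -> G \in unitmx -> G^T = G ->
  (forall i j a, Q i j a = Q j i a) ->
  (forall k, D k = Q k *m G *m J^T + J *m G *m (Q k)^T +
     \sum_c J k c *: (J *m D0 c *m J^T)) ->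
  forall i j a,
  \sum_k christoffel_of (J *m G *m J^T) D k i j * J k a =
  Q i j a + \sum_b \sum_c J i b * J j c * christoffel_of G D0 a b c.
Proof.
move=> Ju Gu Gs Qs DE i j a.
pose s b c e := D0 b c e + D0 c b e - D0 e b c.
pose X e := 2 * (Q i *m G) j e + \sum_b \sum_c J i b * J j c * s b c e.
have S l : D i j l + D j i l - D l i j = \sum_e J l e * X e.
  pose p (i j l : 'I_n) := (Q i *m G *m J^T) j l.
  have pT x y z : (J *m G *m (Q x)^T) y z = p x z y.
    by rewrite /p -[J]trmxK -{1}Gs -!trmx_mul !trmxK mulmxA mxE.
  have ps x y z : p x y z = p y x z.
    rewrite /p !mxE; apply: eq_bigr => b _; rewrite !mxE; congr (_ * _).
    by apply: eq_bigr => c _; rewrite Qs.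
  have DE' x y z : D x y z = p x y z + p x z y +
      \sum_c J x c * \sum_b \sum_e J y b * J z e * D0 c b e.
    rewrite DE mxE [in LHS]mxE pT; congr (_ + _ + _); rewrite summxE.
    by apply: eq_bigr => c _; rewrite mxE congruence_entry.
  have -> : \sum_e J l e * X e = 2 * p i j l +
      \sum_e J l e * \sum_b \sum_c J i b * J j c * s b c e.
    under eq_bigr do rewrite mulrDr.
    rewrite big_split/=; congr (_ + _).
    rewrite /p mxE mulr_sumr; apply: eq_bigr => e _.
    by rewrite [J^T _ _]mxE; ring.
  (* the derivatives of J contribute p i j l twice; the others cancel *)
  rewrite !DE' (ps i l j) (ps j l i) (ps j i l).
  have T1 : \sum_c J i c * (\sum_b \sum_e J j b * J l e * D0 c b e) =
      \sum_b \sum_c \sum_e J i b * J j c * J l e * D0 b c e.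
    apply: eq_bigr => b _; rewrite mulr_sumr; apply: eq_bigr => c _.
    by rewrite mulr_sumr; apply: eq_bigr => e _; ring.
  have T2 : \sum_c J j c * (\sum_b \sum_e J i b * J l e * D0 c b e) =
      \sum_b \sum_c \sum_e J i b * J j c * J l e * D0 c b e.
    rewrite exchange_big/=; apply: eq_bigr => c _; rewrite mulr_sumr.
    apply: eq_bigr => b _; rewrite mulr_sumr.
    by apply: eq_bigr => e _; ring.
  rewrite T1 T2 2!trilinear_sum.
  have -> : \sum_b \sum_c \sum_e J i b * J j c * J l e * s b c e =
    \sum_b \sum_c \sum_e J i b * J j c * J l e * D0 b c e +
    \sum_b \sum_c \sum_e J i b * J j c * J l e * D0 c b e -
    \sum_b \sum_c \sum_e J i b * J j c * J l e * D0 e b c.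
    rewrite -big_split -sumrB/=; apply: eq_bigr => b _.
    rewrite -big_split -sumrB/=; apply: eq_bigr => c _.
    rewrite -big_split -sumrB/=; apply: eq_bigr => e _.
    by rewrite /s; ring.
  by ring.
have -> : \sum_k christoffel_of (J *m G *m J^T) D k i j * J k a =
    2^-1 * \sum_e invmx G a e * X e.
  rewrite -(invmx_congruence Ju Gu) /christoffel_of.
  under eq_bigr do rewrite -mulrA; rewrite -mulr_sumr; congr (_ * _).
  under eq_bigr => k _ do rewrite mulr_suml; rewrite exchange_big/=.
  under [RHS]eq_bigr => e _ do rewrite mxE mulr_suml; rewrite [RHS]exchange_big/=.
  apply: eq_bigr => l _; rewrite S.
  under [RHS]eq_bigr => e _ do rewrite -mulrA.
  rewrite -mulr_sumr mxE mulr_suml; apply: eq_bigr => k _.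
  by rewrite mxE; ring.
rewrite /X; under eq_bigr do rewrite mulrDr.
rewrite big_split/= mulrDr; congr (_ + _).
  have -> : Q i j a = (Q i *m G *m invmx G) j a by rewrite mulmxK.
  rewrite [RHS]mxE mulr_sumr; apply: eq_bigr => e _.
  by rewrite -{1}Gs -trmx_inv mxE mulrCA mulKf// mulrC.
under eq_bigr do rewrite mulr_sumr; rewrite exchange_big mulr_sumr/=.
apply: eq_bigr => b _; under eq_bigr do rewrite mulr_sumr.
rewrite exchange_big mulr_sumr/=; apply: eq_bigr => c _.
rewrite /christoffel_of mulrCA; congr (_ * _); rewrite mulr_sumr.
by apply: eq_bigr => e _; rewrite /s; ring.
Qed.

Lemma trace_congruence J G (H : 'I_n -> 'I_n -> R) : J \in unitmx -> G \in unitmx ->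
  \sum_i \sum_j invmx (J *m G *m J^T) i j * (\sum_b \sum_c J i b * J j c * H b c) =
  \sum_b \sum_c invmx G b c * H b c.
Proof.
move=> Ju Gu; rewrite -(invmx_congruence Ju Gu).
have -> : J^T *m invmx (J *m G *m J^T) *m J =
  J^T *m invmx (J *m G *m J^T) *m (J^T)^T by rewrite trmxK.
under [RHS]eq_bigr => b _ do under eq_bigr => c _ do
  (rewrite congruence_entry mulr_suml; under eq_bigr => i _ do rewrite mulr_suml).
under [RHS]eq_bigr => b _ do
  (rewrite exchange_big/=; under eq_bigr => i _ do rewrite exchange_big/=).
rewrite [RHS]exchange_big/=; apply: eq_bigr => i _.
rewrite [RHS]exchange_big/=; apply: eq_bigr => j _.
rewrite mulr_sumr; apply: eq_bigr => b _; rewrite mulr_sumr.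
by apply: eq_bigr => c _; rewrite !mxE; ring.
Qed.

End TensorAlgebra.

(** * Invariance of the Laplacian *)

Section ChangeOfCoordinates.
Context {R : realType}.

Lemma is_derive_mulmx (V : normedModType R) (m n p : nat) (A : V -> 'M[R]_(m, n))
    (B : V -> 'M[R]_(n, p)) (dA : 'M[R]_(m, n)) (dB : 'M[R]_(n, p)) (y v : V) :
  (forall i j, is_derive y v (fun z => A z i j : R^o) (dA i j)) ->
  (forall i j, is_derive y v (fun z => B z i j : R^o) (dB i j)) ->
  forall i j, is_derive y v (fun z => (A z *m B z) i j : R^o)
    ((dA *m B y + A y *m dB) i j).
Proof.
move=> hA hB i j.
have -> : (fun z => (A z *m B z) i j : R^o) =
    \sum_(k < n) ((fun z => A z i k : R^o) * (fun z => B z k j : R^o)).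
  by apply/funext => z; rewrite mxE fct_sumE.
rewrite !mxE -big_split/=.
have dk k : is_derive y v ((fun z => A z i k : R^o) * (fun z => B z k j : R^o))
    (dA i k * B y k j + A y i k * dB k j).
  apply: is_derive_eq.
  by rewrite addrC [X in X + _]mulrC.
exact: is_derive_sum dk.
Qed.

Lemma jacobianE (m n : nat) (phi : 'rV[R]_m -> 'rV[R]_n) (y : 'rV[R]_m) i j :
  differentiable phi y -> 'J phi y i j = 'D_(delta_mx 0 i) phi y 0 j.
Proof. by move=> dphi; rewrite deriveEjacobian// -rowE [RHS]mxE. Qed.

Lemma is_derive_entry (V : normedModType R) (n : nat) (f : V -> 'rV[R]_n) (y v : V) j :
  derivable f y v -> is_derive y v (fun z => f z 0 j : R^o) ('D_v f y 0 j).
Proof.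
move=> df; apply: DeriveDef; first exact ((derivable_mxP f y v).1 df 0 j).
by rewrite derive_mx// mxE.
Qed.

Lemma derive_entry (V : normedModType R) (n : nat) (f : V -> 'rV[R]_n) (y v : V) j :
  derivable f y v -> 'D_v (fun z => f z 0 j : R^o) y = 'D_v f y 0 j.
Proof. by move=> /(is_derive_entry j)/@derive_val. Qed.

Variable n : nat.
Variables (U U' : set 'rV[R]_n) (phi : 'rV[R]_n -> 'rV[R]_n).
Hypothesis oU : open U.
Hypotheses (phiU : forall y, U y -> U' (phi y)) (phi_smooth : smooth U phi).

Definition coord_hessian (y : 'rV[R]_n) (k : 'I_n) : 'M[R]_n := \matrix_(i, a)
  ('D_(delta_mx 0 k) (fun z => 'D_(delta_mx 0 i) phi z) y) 0 a.

Lemma coord_hessianE y k i a : coord_hessian y k i a =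
  ('D_(delta_mx 0 k) (fun z => 'D_(delta_mx 0 i) phi z) y) 0 a.
Proof. exact: mxE. Qed.

Lemma coord_hessian_sym y i j a : U y -> coord_hessian y i j a = coord_hessian y j i a.
Proof.
move=> Uy.
have E k l : coord_hessian y k l a = 'D_(delta_mx 0 k)
    (fun z => 'D_(delta_mx 0 l) (fun z => phi z 0 a : R^o) z) y.
  set v := delta_mx 0 l; apply: etrans (coord_hessianE _ _ _ _) _; rewrite -/v.
  have d2 := smooth_derivable (v := delta_mx 0 k) (smooth_derive v phi_smooth) Uy.
  apply: etrans (esym (derive_entry a d2)) _; apply: near_eq_derive.
  have : nbhs y U by exact: open_nbhs_nbhs.
  apply: filterS => z Uz; apply/esym/derive_entry.
  exact: smooth_derivable phi_smooth Uz.
apply: etrans (E i j) (etrans _ (esym (E j i))).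
exact: schwarz oU (smooth_entry a oU phi_smooth) Uy.
Qed.

Lemma is_derive_jacobian y k i a : U y ->
  is_derive y (delta_mx 0 k) (fun z => 'J phi z i a : R^o) (coord_hessian y k i a).
Proof.
move=> Uy; suff : is_derive y (delta_mx 0 k) (fun z => 'J phi z i a : R^o)
    (('D_(delta_mx 0 k) (fun z => 'D_(delta_mx 0 i) phi z) y) 0 a).
  by move=> H; apply: (@is_derive_eq _ _ _ _ _ _ _ _ H); exact/esym/coord_hessianE.
apply: (@near_eq_is_derive _ _ R^o (fun z => 'D_(delta_mx 0 i) phi z 0 a : R^o)).
  have : nbhs y U by exact: open_nbhs_nbhs.
  apply: filterS => z Uz; rewrite jacobianE//.
  exact: smooth_differentiable phi_smooth Uz.
apply: is_derive_entry.
exact: smooth_derivable (smooth_derive _ phi_smooth) Uy.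
Qed.

Lemma is_derive_pullback (F : 'rV[R]_n -> R^o) (y v : 'rV[R]_n) :
  smooth U' F -> U y ->
  is_derive y v (fun z => F (phi z) : R^o)
    (\sum_a 'D_v phi y 0 a * partial a F (phi y)).
Proof.
move=> Fs Uy.
have dphi := smooth_differentiable phi_smooth Uy.
have dF := smooth_differentiable Fs (phiU Uy).
apply: DeriveDef.
  by apply: diff_derivable; exact: differentiable_comp.
by rewrite (derive_chain (f := F)) // derive_rV.
Qed.

Section Laplacian.
Variables (g g' : 'rV[R]_n -> 'M[R]_n).
Hypothesis g'_smooth : forall i j, smooth U' (fun z => g' z i j : R^o).
Hypothesis g_pullback : forall y, U y ->
  g y = 'J phi y *m g' (phi y) *m ('J phi y)^T.

Definition dmetric (h : 'rV[R]_n -> 'M[R]_n) y (c : 'I_n) : 'M[R]_n :=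
  \matrix_(a, b) partial c (fun z => h z a b) y.

Lemma christoffelE (h : 'rV[R]_n -> 'M[R]_n) k i j y :
  christoffel h k i j y = christoffel_of (h y) (dmetric h y) k i j.
Proof.
congr (_ * _); apply: eq_bigr => l _; congr (_ * _).
by congr (_ + _ - _); apply/esym; exact: mxE.
Qed.

Lemma dmetric_pullback y k : U y ->
  dmetric g y k =
    coord_hessian y k *m g' (phi y) *m ('J phi y)^T +
    'J phi y *m g' (phi y) *m (coord_hessian y k)^T +
     \sum_c 'J phi y k c *: ('J phi y *m dmetric g' (phi y) c *m ('J phi y)^T).
Proof.
move=> Uy.
pose J z := 'J phi z; pose e := delta_mx 0 k : 'rV[R]_n.
pose dG := \sum_c J y k c *: dmetric g' (phi y) c.
have hJ i j : is_derive y e (fun z => J z i j : R^o) (coord_hessian y k i j).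
  exact: is_derive_jacobian.
have hJT i j : is_derive y e (fun z => (J z)^T i j : R^o) ((coord_hessian y k)^T i j).
  have -> : (fun z => (J z)^T i j) = (fun z => J z j i).
    by apply/funext => z; rewrite mxE.
  by rewrite [(coord_hessian _ _)^T _ _]mxE.
have hG i j : is_derive y e (fun z => g' (phi z) i j : R^o) (dG i j).
  have := is_derive_pullback e (g'_smooth i j) Uy.
  congr is_derive; rewrite summxE; apply: eq_bigr => c _.
  apply: etrans (esym (mxE _ _ _ _)); congr (_ * _); last exact/esym/mxE.
  apply/esym/jacobianE; exact: smooth_differentiable phi_smooth Uy.
have H := is_derive_mulmx (is_derive_mulmx hJ hG) hJT.
apply/matrixP => i j; rewrite mxE.
have -> : partial k (fun z => g z i j) y =
    partial k (fun z => (J z *m g' (phi z) *m (J z)^T) i j) y.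
  apply: near_eq_derive; have : nbhs y U by exact: open_nbhs_nbhs.
  by apply: filterS => z Uz; rewrite g_pullback.
have := @derive_val _ _ _ _ _ _ _ (H i j).
rewrite /partial => ->.
have -> : \sum_c 'J phi y k c *: ('J phi y *m dmetric g' (phi y) c *m ('J phi y)^T) =
  J y *m dG *m (J y)^T.
  rewrite mulmx_sumr mulmx_suml; apply: eq_bigr => c _.
  by rewrite -scalemxAr -scalemxAl.
by rewrite mulmxDl addrAC.
Qed.

(** By [christoffel_transform], the terms in the second derivatives of [phi]
    cancel between the second derivatives of [F \o phi] and the Christoffel
    correction, so the covariant Hessian of [F \o phi] is [J H J^T], where [H]
    is that of [F]; its trace against the inverse metric is then
    [trace_congruence]. *)
Lemma laplacian_pullback (F : 'rV[R]_n -> R^o) y : U y -> smooth U' F ->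
  g y \in unitmx -> (g' (phi y))^T = g' (phi y) ->
  local_laplacian g (fun z => F (phi z)) y = local_laplacian g' F (phi y).
Proof.
move=> Uy Fs gu gs.
move: gu; rewrite (g_pullback Uy) unitmx_mul => /andP[+ _].
rewrite unitmx_mul => /andP[Ju Gu].
have dphi z : U z -> differentiable phi z.
  by move=> Uz; exact: smooth_differentiable phi_smooth Uz.
pose J := 'J phi y; pose Q := coord_hessian y.
have d1 z j : U z -> partial j (fun z => F (phi z)) z =
    \sum_a 'J phi z j a * partial a F (phi z).
  move=> Uz; rewrite /partial.
  rewrite (@derive_val _ _ _ _ _ _ _ (is_derive_pullback _ Fs Uz)).
  by apply: eq_bigr => a _; rewrite jacobianE//; exact: dphi.
(* the first sum is the non-tensorial part, cancelled by the one in chr *)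
have d2 i j : partial i (partial j (fun z => F (phi z))) y =
    \sum_a Q i j a * partial a F (phi y) +
    \sum_b \sum_c J i b * J j c * partial b (partial c F) (phi y).
  have E : \forall z \near y, partial j (fun z => F (phi z)) z =
      \sum_a 'J phi z j a * partial a F (phi z).
    have : nbhs y U by exact: open_nbhs_nbhs.
    by apply: filterS => z; exact: d1.
  rewrite {1}/partial (near_eq_derive _ E).
  have H a : is_derive y (delta_mx 0 i)
      ((fun z => 'J phi z j a : R^o) * (fun z => partial a F (phi z) : R^o))
      (J j a * (\sum_b J i b * partial b (partial a F) (phi y)) +
       partial a F (phi y) * Q i j a).
    have h1 := is_derive_jacobian i j a Uy.
    have h2 := is_derive_pullback (delta_mx 0 i) (smooth_derive (delta_mx 0 a) Fs) Uy.
    apply: is_derive_eq.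
    congr (_ + _); congr (_ * _).
    by apply: eq_bigr => b _; rewrite /J jacobianE//; exact: dphi.
  have -> : (fun z => \sum_a 'J phi z j a * partial a F (phi z)) =
     \sum_a ((fun z => 'J phi z j a : R^o) * (fun z => partial a F (phi z) : R^o)).
    by apply/funext => z; rewrite fct_sumE.
  rewrite (@derive_val _ _ _ _ _ _ _ (is_derive_sum _)).
  rewrite big_split/= addrC; congr (_ + _).
    by apply: eq_bigr => a _; rewrite mulrC.
  rewrite [RHS]exchange_big/=; apply: eq_bigr => c _; rewrite mulr_sumr.
  by apply: eq_bigr => b _; ring.
have cov i j : partial i (partial j (fun z => F (phi z))) y -
    \sum_k christoffel g k i j y * partial k (fun z => F (phi z)) y =
    \sum_b \sum_c J i b * J j c * (partial b (partial c F) (phi y) -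
       \sum_k christoffel g' k b c (phi y) * partial k F (phi y)).
  have -> : \sum_k christoffel g k i j y * partial k (fun z => F (phi z)) y =
    \sum_a (\sum_k christoffel g k i j y * J k a) * partial a F (phi y).
    under eq_bigr => k _ do rewrite d1// mulr_sumr.
    rewrite exchange_big/=; apply: eq_bigr => a _; rewrite mulr_suml.
    by apply: eq_bigr => k _; rewrite mulrA.
  have chr a : \sum_k christoffel g k i j y * J k a =
      Q i j a + \sum_b \sum_c J i b * J j c * christoffel g' a b c (phi y).
    under eq_bigr => k _ do rewrite christoffelE g_pullback//.
    rewrite (@christoffel_transform _ _ J (g' (phi y)) Q (dmetric g' (phi y))) //.
    - by under eq_bigr => b _ do under eq_bigr => c _ do rewrite -christoffelE.
    - by move=> *; exact: coord_hessian_sym.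
    - by move=> k; exact: dmetric_pullback.
  under eq_bigr => a _ do rewrite chr mulrDl.
  have cancel (p q r : R) : p + q - (p + r) = q - r by ring.
  rewrite big_split/= d2 cancel.
  have -> : \sum_a (\sum_b \sum_c J i b * J j c * christoffel g' a b c (phi y)) *
       partial a F (phi y) =
    \sum_b \sum_c J i b * J j c * \sum_a christoffel g' a b c (phi y) * partial a F (phi y).
    under eq_bigr do rewrite mulr_suml.
    rewrite exchange_big/=; apply: eq_bigr => b _.
    under eq_bigr do rewrite mulr_suml.
    rewrite exchange_big/=; apply: eq_bigr => c _; rewrite mulr_sumr.
    by apply: eq_bigr => a _; exact/esym/mulrA.
  rewrite -sumrB; apply: eq_bigr => b _; rewrite -sumrB; apply: eq_bigr => c _.
  by rewrite mulrBr.
rewrite /local_laplacian.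
under eq_bigr => i _ do under eq_bigr => j _ do rewrite cov.
rewrite g_pullback//.
exact: (@trace_congruence _ _ J (g' (phi y)) (fun b c => _)).
Qed.

End Laplacian.
End ChangeOfCoordinates.

(** * Continuity of the Laplacian in a chart, and its sign at a maximum *)

Section MatrixContinuity.
Context {R : realType} {T : Type} {F : set_system T} {FF : Filter F}.

Lemma cvg_sum_ord (n : nat) (f : 'I_n -> T -> R) (l : 'I_n -> R) :
  (forall i, f i x @[x --> F] --> l i) ->
  \sum_i f i x @[x --> F] --> \sum_i l i.
Proof. by move=> fl; apply: cvg_big => //; exact: add_continuous. Qed.

Lemma cvg_det (n : nat) (A : T -> 'M[R]_n) (L : 'M[R]_n) :
  (forall i j, A x i j @[x --> F] --> L i j) ->
  \det (A x) @[x --> F] --> \det L.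
Proof.
move=> AL; apply: cvg_big => [|s _]; first exact: add_continuous.
apply: cvgM; first exact: cvg_cst.
by apply: cvg_big => [|i _]; [exact: mul_continuous|exact: AL].
Qed.

Lemma cvg_invmx (n : nat) (A : T -> 'M[R]_n) (L : 'M[R]_n) :
  (forall i j, A x i j @[x --> F] --> L i j) -> L \in unitmx ->
  forall i j, invmx (A x) i j @[x --> F] --> invmx L i j.
Proof.
move=> AL Lu i j.
have dL := cvg_det AL.
have L0 : \det L != 0 by rewrite -unitfE.
have E : {near F, (fun x => (\det (A x))^-1 * cofactor (A x) j i) =1
    (fun x => invmx (A x) i j)}.
  have : \forall x \near F, \det (A x) != 0 by exact: cvgr_neq0 dL L0.
  by apply: filterS => x Ax0; rewrite /invmx unitmxE unitfE Ax0 !mxE.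
apply: cvg_trans (near_eq_cvg E) _.
rewrite /invmx Lu !mxE; apply: cvgM; first exact: cvgV.
apply: cvgM; first exact: cvg_cst.
apply: cvg_det => k l; rewrite !mxE.
by under eq_cvg do rewrite !mxE; exact: AL.
Qed.

End MatrixContinuity.

Section LocalLaplacian.
Context {R : realType} {n : nat}.
Variables (U : set 'rV[R]_n) (g : 'rV[R]_n -> 'M[R]_n).
Hypothesis oU : open U.

Lemma local_laplacian_eq (f f' : 'rV[R]_n -> R) y : U y ->
  (forall z, U z -> f z = f' z) -> local_laplacian g f y = local_laplacian g f' y.
Proof.
move=> Uy ff'.
have N (p q : 'rV[R]_n -> R) z i : U z -> (forall z, U z -> p z = q z) ->
    partial i p z = partial i q z.
  move=> Uz pq; apply: near_eq_derive.
  by have : nbhs z U by [exact: open_nbhs_nbhs]; exact: filterS.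
rewrite /local_laplacian; apply: eq_bigr => i _; apply: eq_bigr => j _.
rewrite (N _ _ _ i Uy (fun z Uz => N f f' z j Uz ff')).
by under eq_bigr => k _ do rewrite (N f f' y k Uy ff').
Qed.

Hypothesis g_smooth : forall i j, smooth U (fun z => g z i j : R^o).
Hypothesis g_unit : forall y, U y -> g y \in unitmx.

Lemma continuous_local_laplacian (f : 'rV[R]_n -> R^o) y : U y -> smooth U f ->
  {for y, continuous (local_laplacian g f)}.
Proof.
move=> Uy fs.
suff : local_laplacian g f z @[z --> y] --> local_laplacian g f y by [].
have FF := nbhs_filter y.
have gc i j : g z i j @[z --> y] --> g y i j.
  exact: smooth_continuous (g_smooth i j) Uy.
have dg k i j : partial k (fun z => g z i j) z @[z --> y] -->
    partial k (fun z => g z i j) y.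
  exact: smooth_continuous (smooth_derive _ (g_smooth i j)) Uy.
have df k : partial k f z @[z --> y] --> partial k f y.
  exact: smooth_continuous (smooth_derive _ fs) Uy.
have d2f i j : partial i (partial j f) z @[z --> y] --> partial i (partial j f) y.
  exact: smooth_continuous (smooth_derive _ (smooth_derive _ fs)) Uy.
have gu := g_unit Uy; move: FF gc dg df d2f.
move: (nbhs y) => F FF gc dg df d2f.
have inv i j : invmx (g z) i j @[z --> F] --> invmx (g y) i j.
  exact: cvg_invmx.
have chr k i j : christoffel g k i j z @[z --> F] --> christoffel g k i j y.
  apply: cvgM; first exact: cvg_cst.
  apply: cvg_sum_ord => l; apply: cvgM; first exact: inv.
  by apply: cvgB; [apply: cvgD|]; exact: dg.
apply: cvg_sum_ord => i; apply: cvg_sum_ord => j.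
apply: cvgM; first exact: inv.
apply: cvgB; first exact: d2f.
by apply: cvg_sum_ord => k; apply: cvgM; [exact: chr|exact: df].
Qed.

End LocalLaplacian.

Section LocalMaximum.
Context {R : realType}.

Lemma second_derive_rV (n : nat) (U : set 'rV[R]_n) (f : 'rV[R]_n -> R^o) (v y : 'rV[R]_n) :
  open U -> smooth U f -> U y ->
  'D_v (fun z => 'D_v f z) y =
  \sum_i \sum_j v 0 i * v 0 j * partial i (partial j f) y.
Proof.
move=> oU fs Uy.
rewrite (derive_rV v (smooth_differentiable (smooth_derive v fs) Uy)).
apply: eq_bigr => i _.
have -> : 'D_(delta_mx 0 i) (fun z => 'D_v f z) y =
    'D_(delta_mx 0 i) (\sum_j (v 0 j \*: (partial j f : _ -> R^o))) y.
  apply: near_eq_derive; have : nbhs y U by exact: open_nbhs_nbhs.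
  apply: filterS => z Uz.
  by rewrite (derive_rV v (smooth_differentiable fs Uz)) fct_sumE.
have df j : derivable (partial j f : _ -> R^o) y (delta_mx 0 i).
  exact: smooth_derivable (smooth_derive _ fs) Uy.
rewrite derive_sum => [|j]; last exact: derivableZ.
rewrite scaler_sumr; apply: eq_bigr => j _.
by rewrite deriveZ// /GRing.scale/= mulrA.
Qed.

(** Completing the square,
    [B00 * tr (B H) = w H w^T + (B00 * B11 - B01 ^ 2) * H11] with
    [w = (B00, B01)], and both terms are nonpositive. *)
Lemma trace_posdef_seminegdef (B H : 'M[R]_2) :
  B^T = B -> (forall v : 'rV[R]_2, v != 0 -> 0 < (v *m B *m v^T) 0 0) ->
  (forall v : 'rV[R]_2, \sum_i \sum_j v 0 i * v 0 j * H i j <= 0) ->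
  \sum_i \sum_j B i j * H i j <= 0.
Proof.
move=> Bs Bp Hn.
have sum2 (F : 'I_2 -> R) : \sum_i F i = F 0 + F 1.
  by rewrite big_ord_recl big_ord1; congr (_ + F _); exact: val_inj.
have B10 : B 1 0 = B 0 1 by rewrite -[in LHS]Bs mxE.
pose vec (p q : R) : 'rV[R]_2 := \row_j (if j == 0 then p else q).
have vec0 p q : vec p q 0 0 = p by rewrite mxE.
have vec1 p q : vec p q 0 1 = q by rewrite mxE.
have quad p q : (vec p q *m B *m (vec p q)^T) 0 0 =
    p ^+ 2 * B 0 0 + 2 * p * q * B 0 1 + q ^+ 2 * B 1 1.
  by rewrite congruence_entry !sum2 !vec0 !vec1 B10; ring.
have a0 : 0 < B 0 0.
  have /Bp : vec 1 0 != 0.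
    by apply/eqP => /rowP/(_ 0); rewrite vec0 mxE => /eqP; rewrite oner_eq0.
  by rewrite quad; lra.
(* The form takes the value B 0 0 * det B at the vector (- B 0 1, B 0 0). *)
have d0 : 0 < B 0 0 * B 1 1 - B 0 1 ^+ 2.
  have /Bp : vec (- B 0 1) (B 0 0) != 0.
    apply/eqP => /rowP/(_ 1); rewrite vec1 mxE => a00.
    by rewrite a00 ltxx in a0.
  rewrite quad => pos; rewrite -(pmulr_rgt0 _ a0).
  by move: pos; congr (0 < _); ring.
have := Hn (vec (B 0 0) (B 0 1)); have := Hn (vec 0 1).
rewrite !sum2 !vec0 !vec1 => H11 HB.
have {}H11 : H 1 1 <= 0 by move: H11; lra.
rewrite -(pmulr_rle0 _ a0) B10.
have -> : B 0 0 * (B 0 0 * H 0 0 + B 0 1 * H 0 1 + (B 0 1 * H 1 0 + B 1 1 * H 1 1)) =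
  (B 0 0 * B 0 0 * H 0 0 + B 0 0 * B 0 1 * H 0 1 +
    (B 0 1 * B 0 0 * H 1 0 + B 0 1 * B 0 1 * H 1 1)) +
  (B 0 0 * B 1 1 - B 0 1 ^+ 2) * H 1 1 by ring.
by rewrite -[leRHS]addr0 lerD// mulr_ge0_le0// ltW.
Qed.

End LocalMaximum.


(** * The Laplacian on a manifold *)

Section Charts.
Context {R : realType} {n : nat} {M : smooth_manifold R n}.
Implicit Types c d : chart R M n.

Lemma open_overlap c d : open (overlap c d).
Proof.
rewrite openE => y [cy dy]; apply: filterI.
  by apply: open_nbhs_nbhs; split => //; exact: open_cod.
apply: (prm_continuous cy).
by apply: open_nbhs_nbhs; split => //; exact: open_dom.
Qed.

Lemma transition_overlap c d y : overlap c d y -> cod d (transition c d y).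
Proof. by move=> [_ dy]; exact: crd_cod. Qed.

Lemma chart_atP (x : M) : atlas M (chart_at x) /\ dom (chart_at x) x.
Proof. exact: projT2 (cid (atlas_cover x)). Qed.

Lemma smooth_fun_continuous (f : M -> R) : smooth_fun f -> continuous f.
Proof.
move=> fs x; have [ac cx] := chart_atP x; set c := chart_at x in ac cx.
have E : {near x, (fun z => f (prm c (crd c z))) =1 f}.
  have : nbhs x (dom c) by apply: open_nbhs_nbhs; split => //; exact: open_dom.
  by apply: filterS => z cz /=; rewrite crdK.
suff : f (prm c (crd c z)) @[z --> x] --> f (prm c (crd c x)).
  by rewrite crdK// => H; exact: cvg_trans (near_eq_cvg E) H.
apply: (@continuous_comp _ _ _ (crd c) (fun y => f (prm c y))).
  exact: crd_continuous cx.
exact: smooth_continuous (fs c ac) (crd_cod cx).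
Qed.

Variable h : riemannian_metric M.

(** A vector of the kernel would have length zero. *)
Lemma metric_unit c y : atlas M c -> cod c y -> h c y \in unitmx.
Proof.
move=> ac cy; rewrite -row_free_unit -kermx_eq0; apply/negPn/negP => k0.
have v0 : nz_row (kermx (h c y)) != 0 by rewrite nz_row_eq0.
have := metric_pos h ac cy v0.
have /sub_kermxP -> := nz_row_sub (kermx (h c y)).
by rewrite mul0mx mxE ltxx.
Qed.

Lemma local_laplacian_chart (f : M -> R) c d x : smooth_fun f ->
  atlas M c -> atlas M d -> dom c x -> dom d x ->
  local_laplacian (h c) (fun y => f (prm c y)) (crd c x) =
  local_laplacian (h d) (fun y => f (prm d y)) (crd d x).
Proof.
move=> fs ac ad cx dx.
have oU := @open_overlap c d.
have Ux : overlap c d (crd c x) by split; [exact: crd_cod|rewrite crdK].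
have phix : transition c d (crd c x) = crd d x by rewrite /transition crdK.
rewrite -phix -(@laplacian_pullback _ _ (overlap c d) (cod d) (transition c d)
  oU (@transition_overlap c d) (atlas_compatible ac ad) (h c)) //.
- apply: (local_laplacian_eq _ oU Ux) => z [cz dz].
  by rewrite /transition crdK.
- exact: metric_smooth.
- by move=> y Uy; exact: metric_compatible.
- exact: fs.
- exact/metric_unit/crd_cod.
- exact: (Defs.metric_sym h ad (transition_overlap Ux)).
Qed.

End Charts.

Section SurfaceLaplacian.
Context {R : realType} {M : smooth_manifold R 2}.
Variable h : riemannian_metric M.

Lemma laplacianE (f : M -> R) c x : smooth_fun f -> atlas M c -> dom c x ->
  laplacian h f x = local_laplacian (h c) (fun y => f (prm c y)) (crd c x).
Proof.
by move=> fs ac cx; have [? ?] := chart_atP x; exact: local_laplacian_chart.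
Qed.

Lemma laplacian_continuous (f : M -> R) : smooth_fun f ->
  continuous (laplacian h f).
Proof.
move=> fs x; have [ac cx] := chart_atP x; set c := chart_at x in ac cx.
pose L := local_laplacian (h c) (fun y => f (prm c y)).
have E : {near x, (fun z => L (crd c z)) =1 laplacian h f}.
  have : nbhs x (dom c) by apply: open_nbhs_nbhs; split => //; exact: open_dom.
  by apply: filterS => z cz /=; rewrite (laplacianE fs ac cz).
suff H : L (crd c z) @[z --> x] --> L (crd c x).
  by apply: cvg_trans (near_eq_cvg E) _; rewrite (laplacianE fs ac cx).
apply: (@continuous_comp _ _ _ (crd c) L); first exact: crd_continuous cx.
apply: (@continuous_local_laplacian _ _ (cod c)).
- exact: metric_smooth.
- by move=> y; exact: metric_unit.
- exact: crd_cod.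
- exact: fs.
Qed.

(** In coordinates the first derivatives vanish, so only the Hessian is left in
    the Laplacian; it is negative semidefinite and the inverse metric is positive
    definite. *)
Lemma laplacian_at_max (f : M -> R) x : smooth_fun f ->
  (forall z, f z <= f x) -> laplacian h f x <= 0.
Proof.
move=> fs fmax; rewrite /laplacian /=.
have [ac cx] := chart_atP x; set c := chart_at x in ac cx *.
pose y := crd c x; have cy : cod c y := crd_cod cx.
pose f0 y := f (prm c y).
have f0s : smooth (cod c) (f0 : _ -> R^o) := fs c ac.
have f0max z : cod c z -> f0 z <= f0 y by move=> _; rewrite /f0 crdK.
have oc : open (cod c) by exact: open_cod.
have gu := metric_unit h ac cy.
rewrite /local_laplacian -/y -/f0.
have E i j : partial i (partial j f0) y -
    \sum_(k < 2) christoffel (h c) k i j y * partial k f0 y =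
    (\matrix_(i, j) partial i (partial j f0) y) i j.
  rewrite mxE big1 ?subr0// => k _.
  by rewrite /partial (derive_at_max _ oc f0s cy f0max) mulr0.
under eq_bigr => i _ do under eq_bigr => j _ do rewrite E.
apply: trace_posdef_seminegdef.
- by rewrite trmx_inv Defs.metric_sym.
(* The inverse metric at v is the metric at v *m invmx (h c y). *)
- move=> v v0.
  have w0 : v *m invmx (h c y) != 0.
    by apply: contraNneq v0 => w0; rewrite -[v](mulmxKV gu) w0 mul0mx.
  have := metric_pos h ac cy w0.
  by rewrite mulmxKV// trmx_mul trmx_inv Defs.metric_sym// mulmxA.
- move=> v; have := second_derive_at_max v oc f0s cy f0max.
  rewrite (second_derive_rV v oc f0s cy).
  by under [X in _ -> X <= _]eq_bigr => i _ do under eq_bigr => j _ do rewrite mxE.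
Qed.

End SurfaceLaplacian.

(** * Smooth evolutions *)

Section TimeDerivative.
Context {R : realType}.

Lemma continuous_pair (X Y Z : topologicalType) (f : X -> Y) (g : X -> Z) x :
  {for x, continuous f} -> {for x, continuous g} ->
  {for x, continuous (fun z => (f z, g z))}.
Proof. by move=> fx gx; exact: cvg_pair. Qed.

Lemma near_time (T : \bar R) (t : R) : 0 < t -> (t%:E < T)%E ->
  \forall s \near t, 0 <= s /\ (s%:E < T)%E.
Proof.
move=> t0 tT.
have s0 : \forall s \near t, 0 <= s.
  by near=> s; apply: ltW; near: s; exact: lt_nbhsr.
have sT : \forall s \near t, (s%:E < T)%E.
  case: T tT => [r| |//]; last by move=> _; near=> s; rewrite ltry.
  by rewrite lte_fin => tr; near=> s; rewrite lte_fin; near: s; exact: lt_nbhsl.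
by move: s0 sT; apply: filterS2.
Unshelve. all: by end_near. Qed.

(** A positive time [t < T] is interior to the time interval, so restricting the
    difference quotient to that interval changes nothing. *)
Lemma has_time_derivative_is_derive (T : \bar R) (u : R -> R) (t a : R) :
  0 < t -> (t%:E < T)%E -> has_time_derivative T u t a -> is_derive t 1 u a.
Proof.
move=> t0 tT ua.
have shift : (h *: (1 : R) + t) @[h --> (0 : R)^'] -->
    within [set s | 0 <= s /\ (s%:E < T)%E] t^'.
  move=> P; rewrite /= /within/= => Pt.
  have cs : {for 0, continuous (fun h : R^o => h *: (1 : R^o) + t)}.
    by apply: cvgD; [exact: cvgZr_tmp|exact: cvg_cst].
  have tE : 0 *: (1 : R^o) + t = t by rewrite scale0r add0r.
  have N : \forall s \near t, s != t -> P s.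
    have {}Pt : \forall s \near t, s != t -> 0 <= s /\ (s%:E < T)%E -> P s := Pt.
    by move: Pt (near_time t0 tT); apply: filterS2 => s Ps As st; exact: Ps.
  have {}cs : \forall h \near (0 : R), h *: (1 : R^o) + t != t -> P (h *: (1 : R^o) + t).
    by have := cs (fun s => s != t -> P s); rewrite tE; exact.
  suff : \forall h \near (0 : R), h != 0 -> P (h *: (1 : R) + t) by [].
  move: cs; apply: filterS => h Ph h0; apply: Ph.
  by rewrite /GRing.scale/= mulr1 -subr_eq0 addrK.
have ua' : h^-1 *: (u (h *: 1 + t) - u t) @[h --> (0 : R)^'] --> a.
  have E : (fun h : R => h^-1 *: (u (h *: 1 + t) - u t)) =
      (fun s => (s - t)^-1 * (u s - u t)) \o (fun h : R => h *: 1 + t).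
    by apply/funext => h /=; rewrite addrK /GRing.scale/= mulr1.
  by rewrite E; exact: cvg_comp shift ua.
by apply: DeriveDef; [apply/cvg_ex; exists a|exact/cvg_lim].
Qed.

End TimeDerivative.

Section Evolution.
Context {R : realType} {M : smooth_manifold R 2}.
Variables (T : \bar R) (p : R -> M -> R).
Hypothesis p_smooth : smooth_evolution T p.

Lemma evolution_slice t : 0 <= t -> (t%:E < T)%E -> smooth_fun (p t).
Proof.
move=> t0 tT c ac; apply: smooth_local => y cy.
have [//|U [F [oU Uty Fs FE]]] := p_smooth ac (a := (t, y)).
pose U' := [set z | U (t, z)] `&` cod c.
have oU' : open U'.
  apply: openI; last exact: open_cod.
  apply: (open_comp (f := fun z : 'rV[R]_2 => (t, z) : R^o * 'rV[R]_2)) => // z _.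
  by apply: continuous_pair => //; exact: cst_continuous.
exists U'; first by [].
apply: (smooth_eq oU' (f := fun z => F (t, z))).
  by move=> z [Uz cz]; apply: FE.
by apply: smooth_sub (smooth_slice t Fs) => z [].
Qed.

Lemma evolution_continuous t1 : (t1%:E < T)%E ->
  {within `[0, t1] `*` [set: M], continuous (fun q : R * M => p q.1 q.2)}.
Proof.
move=> t1T; apply/subspace_continuousP => -[s x] [/=].
rewrite in_itv/= => /andP[s0 st1] _.
have [ac cx] := chart_atP x; set c := chart_at x in ac cx.
have sT : (s%:E < T)%E by rewrite (le_lt_trans _ t1T)// lee_fin.
have [|U [F [oU Usy Fs FE]]] := p_smooth ac (a := (s, crd c x)).
  by split => //=; split => //; exact: crd_cod.
pose q2 (q : R * M) : R^o * 'rV[R]_2 := (q.1, crd c q.2).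
have cq : q2 q @[q --> (s, x)] --> q2 (s, x).
  apply: (@continuous_pair _ _ _ (fst : R * M -> R^o) (fun q => crd c q.2)).
    exact: cvg_fst.
  apply: (@continuous_comp _ _ _ snd (crd c)); first exact: cvg_snd.
  exact: crd_continuous cx.
rewrite /from_subspace /=; have <- : F (s, crd c x) = p s x.
  rewrite FE//= ?crdK//; split => //; split => //; exact: crd_cod.
have H : F (q2 q) @[q --> (s, x)] --> F (s, crd c x).
  by apply: cvg_comp; [exact: cq|exact: smooth_continuous Fs Usy].
have {}H : F (q2 q) @[q --> within (`[0, t1] `*` [set: M]) (nbhs (s, x))] -->
    F (s, crd c x) by exact: cvg_within_filter.
apply: cvg_trans H; apply: near_eq_cvg.
have N1 : \forall q \near (s, x), U (q2 q).
  by apply: cq; exact: open_nbhs_nbhs.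
have N2 : \forall q \near (s, x), dom c q.2.
  apply: cvg_snd; apply: open_nbhs_nbhs; split => //; exact: open_dom.
rewrite /within/=; move: N1 N2; apply: filterS2 => -[s' x'] /= Uq cx' [+ _].
rewrite in_itv/= => /andP[s'0 s't1]; rewrite FE ?crdK//.
split => //=; split; last exact: crd_cod.
by rewrite (le_lt_trans _ t1T)// lee_fin.
Qed.

(** Near a point of [M] the time derivative is the derivative, in the direction
    [(1, 0)], of a smooth function on an open subset of space-time. *)
Lemma evolution_time_derive_continuous t : 0 < t -> (t%:E < T)%E ->
  continuous (fun x => 'D_1 (fun s => p s x : R^o) t).
Proof.
move=> t0 tT x.
have [ac cx] := chart_atP x; set c := chart_at x in ac cx.
have [|U [F [oU Uty Fs FE]]] := p_smooth ac (a := (t, crd c x)).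
  by split => /=; [exact: ltW|split => //; exact: crd_cod].
pose q2 (x : M) : R^o * 'rV[R]_2 := (t, crd c x).
pose DF := fun z => 'D_((1, 0) : R^o * 'rV[R]_2) F z.
have cq : q2 z @[z --> x] --> q2 x.
  by apply: continuous_pair; [exact: cst_continuous|exact: crd_continuous cx].
have E : {near x, (fun z => DF (q2 z)) =1 (fun x => 'D_1 (fun s => p s x : R^o) t)}.
  have N1 : \forall z \near x, U (q2 z) by apply: cq; exact: open_nbhs_nbhs.
  have N2 : \forall z \near x, dom c z.
    by apply: open_nbhs_nbhs; split => //; exact: open_dom.
  move: N1 N2; apply: filterS2 => z Uz cz.
  rewrite /DF -(derive_pair_fst F (1 : R^o)).
  apply: near_eq_derive.
  have N3 : \forall s \near t, U (s, crd c z).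
    have cs : {for t, continuous (fun s => (s, crd c z) : R^o * 'rV[R]_2)}.
      by apply: continuous_pair; [exact: cvg_id|exact: cst_continuous].
    have : nbhs (t, crd c z) U by exact: open_nbhs_nbhs.
    exact: cs.
  move: N3 (near_time t0 tT); apply: filterS2 => s Us [s0 sT].
  by rewrite FE//= ?crdK//; split => //; split => //; exact: crd_cod.
have H : DF (q2 z) @[z --> x] --> DF (q2 x).
  by apply: cvg_comp; [exact: cq|exact: smooth_continuous (smooth_derive _ Fs) Uty].
apply: cvg_trans (near_eq_cvg E) _.
by rewrite -(nbhs_singleton E).
Qed.

End Evolution.

(** * The Ricci flow *)

Section RicciFlow.
Context {R : realType} {M : smooth_manifold R 2}.
Variables (h : riemannian_metric M) (p0 : M -> R).

Lemma ricci_flow_derive (T : \bar R) (p : R -> M -> R) t x :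
  ricci_flow h p0 T p -> 0 < t -> (t%:E < T)%E ->
  is_derive t 1 (fun s => p s x)
    (expR (- (2 * p t x)) * (laplacian h (p t) x - gauss_curvature h x)).
Proof.
move=> [_ _ flow] t0 tT; apply: (has_time_derivative_is_derive t0 tT).
exact: flow (ltW t0) tT.
Qed.

(** The flow equation at a fixed positive time expresses the curvature through
    the Laplacian and the time derivative of the solution, which are continuous. *)
Lemma gauss_curvature_continuous (T : \bar R) (p : R -> M -> R) :
  ricci_flow h p0 T p -> (0 < T)%E -> continuous (gauss_curvature h).
Proof.
move=> flow T0; have [ps _ _] := flow.
have [t t0 tT] : exists2 t : R, 0 < t & (t%:E < T)%E.
  case: T T0 {flow ps} => [r| |//].
    by rewrite lte_fin => r0; exists (r / 2); rewrite ?divr_gt0// lte_fin; lra.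
  by move=> _; exists 1; rewrite ?ltry.
have pts : smooth_fun (p t) := evolution_slice ps (ltW t0) tT.
have -> : gauss_curvature h = fun x =>
    laplacian h (p t) x - expR (2 * p t x) * 'D_1 (fun s => p s x : R^o) t.
  apply/funext => x.
  have -> := @derive_val _ _ _ _ _ _ _ (ricci_flow_derive x flow t0 tT).
  by rewrite mulrA -expRD subrr expR0 mul1r subKr.
move=> x; apply: cvgB; first exact: laplacian_continuous.
apply: cvgM; last exact: evolution_time_derive_continuous tT x.
apply: (@continuous_comp _ _ _ (fun x => 2 * p t x) expR); last exact: continuous_expR.
by apply: cvgM; [exact: cvg_cst|exact: smooth_fun_continuous].
Qed.

Lemma no_max_from_left (w : R -> R) (s a : R) : is_derive s 1 w a -> a < 0 ->
  0 < s -> (forall r, 0 <= r <= s -> w r <= w s) -> False.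
Proof.
move=> [dw wa] a0 s0 wmax.
have : h0^-1 *: (w (h0 *: 1 + s) - w s) @[h0 --> (0 : R)^'] --> a by rewrite -wa; exact: dw.
move=> /cvgr_lt/(_ _ a0)/nbhs_ballP[e /= e0 eP].
pose d := Num.min (e / 2) s.
have d0 : 0 < d by rewrite lt_min s0 divr_gt0.
have de : d < e by rewrite gt_min; apply/orP; left; lra.
have ds : d <= s by rewrite ge_min lexx orbT.
have := eP (- d); rewrite /ball/= sub0r opprK gtr0_norm// => /(_ de).
rewrite oppr_eq0 gt_eqF// => /(_ isT).
rewrite [- d *: _]mulr1 /GRing.scale/= nmulr_rlt0 ?invr_lt0 ?oppr_lt0//.
rewrite subr_gt0 ltNge wmax//; apply/andP; split; lra.
Qed.

(** The maximum principle.  The slope [2 * k - d] instead of [2 * k] makes the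
    time derivative at a spatial maximum strictly negative, so that the maximum
    over space-time can only occur at the initial time. *)
Lemma ricci_flow_upper_bound (T : \bar R) (p : R -> M -> R) (C k : R) :
  compact [set: M] -> ricci_flow h p0 T p ->
  (forall x, k <= gauss_curvature h x) -> (forall x, expR (2 * p0 x) <= C) ->
  forall t x, 0 <= t -> (t%:E < T)%E -> expR (2 * p t x) <= C - 2 * t * k.
Proof.
move=> cM flow Kk p0C t x t0 tT; have [ps pinit _] := flow.
apply/ler_addgt0Pl => e e0.
(* Any positive d with t * d <= e would do; t may be 0. *)
pose d := e / (t + 1).
have t10 : 0 < t + 1 by lra.
have d0 : 0 < d by rewrite divr_gt0.
have dt : t * d <= e.
  by rewrite /d mulrA ler_pdivrMr// mulrC ler_pM2l//; lra.
pose w s z := expR (2 * p s z) + s * (2 * k - d).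
have wc : {within `[0, t] `*` [set: M], continuous (fun q : R * M => w q.1 q.2)}.
  have /subspace_continuousP pc := evolution_continuous ps tT.
  apply/subspace_continuousP => q Aq; apply: cvgD.
    apply: (@cvg_comp _ _ _ (fun q : R * M => 2 * p q.1 q.2) expR);
      last exact: continuous_expR.
    by apply: cvgM; [exact: cvg_cst|exact: pc].
  apply: cvgM; last exact: cvg_cst.
  by apply: cvg_within_filter; exact: cvg_fst.
have Atx : (`[0, t] `*` [set: M]) (t, x) by split => //=; rewrite in_itv/= t0 lexx.
have [||[s y]] := @compact_EVT_max _ _ _ (`[0, t] `*` [set: M]) _ _ wc.
- by exists (t, x).
- by apply: compact_setX => //; exact: segment_compact.
rewrite inE => -[/=]; rewrite in_itv/= => /andP[s0 st] _ wmax.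
have {}wmax r z : 0 <= r <= t -> w r z <= w s y.
  by move=> rt; apply: (wmax (r, z)); rewrite inE; split => //=; rewrite in_itv.
suff wC : w s y <= C.
  have := wmax t x; rewrite lexx t0 => /(_ isT); rewrite /w in wC *; lra.
have [s00|sn0] := eqVneq s 0.
  by rewrite /w s00 mul0r addr0 pinit.
have {s0 sn0}s0 : 0 < s by rewrite lt_neqAle eq_sym sn0.
have sT : (s%:E < T)%E by rewrite (le_lt_trans _ tT)// lee_fin.
exfalso.
have lap0 : laplacian h (p s) y <= 0.
  apply: laplacian_at_max; first exact: evolution_slice (ltW s0) sT.
  move=> z; have := wmax s z; rewrite (ltW s0) st => /(_ isT).
  by rewrite /w lerD2r ler_expR ler_pM2l.
have dp := ricci_flow_derive y flow s0 sT.
set a := _ * _ in dp.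
have dw : is_derive s 1 (fun r => w r y) (2 * expR (2 * p s y) * a + (2 * k - d)).
  have d1 : is_derive s 1 (fun r : R => 2 * p r y) (2 * a) by exact: is_deriveZ.
  have d2 : is_derive s 1 (expR \o (fun r : R => 2 * p r y))
      (expR (2 * p s y) * (2 * a)) by exact: is_derive1_comp.
  have d3 : is_derive s 1 (fun r : R => (2 * k - d) * r) ((2 * k - d) * 1).
    exact: is_deriveZ.
  have -> : (fun r => w r y) =
      (expR \o (fun r : R => 2 * p r y)) + (fun r : R => (2 * k - d) * r).
    by apply/funext => r; rewrite /w [r * _]mulrC.
  by apply: is_derive_eq; rewrite mulr1; ring.
apply: (no_max_from_left dw _ s0).
  have -> : 2 * expR (2 * p s y) * a = 2 * (laplacian h (p s) y - gauss_curvature h y).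
    by rewrite /a -mulrA [expR _ * (_ * _)]mulrA -expRD subrr expR0 mul1r.
  have := Kk y; lra.
by move=> r /andP[r0 rs]; apply: wmax; rewrite r0 (le_trans rs).
Qed.

End RicciFlow.

Theorem mainTheorem20 (R : realType) (M : smooth_manifold R 2)
    (h : riemannian_metric M) (p0 : M -> R)
    (M_nonempty : [set: M] !=set0)
    (M_compact : compact [set: M])
    (K_pos : forall x : M, 0 < gauss_curvature h x)
    (p0_smooth : smooth_fun p0) :
  let K0 := inf (range (gauss_curvature h)) in
  (forall (T : \bar R) (p : R -> M -> R), ricci_flow h p0 T p ->
     forall (t : R) (x : M), 0 <= t -> (t%:E < T)%E ->
       expR (2 * p t x) <= expR (2 * uniform_norm p0) - 2 * t * K0) /\
  (extinction_time h p0 \is a fin_num /\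
   (extinction_time h p0 <= (expR (2 * uniform_norm p0) / (2 * K0))%:E)%E).
Proof.
move=> K0; set C := expR (2 * uniform_norm p0).
have KK0 x : K0 <= gauss_curvature h x.
  by apply: ge_inf; [exists 0 => _ [z _ <-]; exact: ltW|exists x].
have p0C x : expR (2 * p0 x) <= C.
  rewrite ler_expR ler_pM2l//; apply: le_trans (ler_norm _) _.
  have nc : continuous (fun x => `|p0 x|).
    by move=> z; apply: cvg_norm; exact: smooth_fun_continuous.
  have [c _ cmax] := compact_EVT_max M_nonempty M_compact (continuous_subspaceT nc).
  apply: ub_le_sup; last by exists x.
  by exists `|p0 c| => _ [z _ <-]; apply: cmax; rewrite inE.
have bound T p (flow : ricci_flow h p0 T p) t x : 0 <= t -> (t%:E < T)%E ->
    expR (2 * p t x) <= C - 2 * t * K0.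
  exact: (ricci_flow_upper_bound M_compact flow KK0 p0C).
split; first exact: bound.
have K0_ge0 : 0 <= K0.
  apply: lb_le_inf => [|_ [z _ <-]]; last exact: ltW.
  by case: M_nonempty => x _; exists (gauss_curvature h x), x.
(* The constant evolution is vacuously a solution for T = 0. *)
have T0 : (0 <= extinction_time h p0)%E.
  apply: ereal_sup_ubound; split => //; exists (fun _ => p0); split => //.
  - move=> c _ [s y] [/= s0 [+ _]]; rewrite lte_fin => s00.
    by have := le_lt_trans s0 s00; rewrite ltxx.
  - move=> s y s0; rewrite lte_fin => s00.
    by have := le_lt_trans s0 s00; rewrite ltxx.
have Tle : (extinction_time h p0 <= (C / (2 * K0))%:E)%E.
  apply: ge_ereal_sup => T [T_ge0 [p flow]].
  (* The bound at the time C / (2 * K0) needs K0 > 0, and its proof uses the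
     solution at a positive time. *)
  have [|Tpos] := leP T 0%E.
    move=> /le_trans; apply.
    by rewrite lee_fin divr_ge0 ?expR_ge0// mulr_ge0.
  have [c _ cmin] := compact_EVT_min M_nonempty M_compact
    (continuous_subspaceT (gauss_curvature_continuous flow Tpos)).
  have K0_gt0 : 0 < K0.
    apply: lt_le_trans (K_pos c) _; apply: lb_le_inf => [|_ [z _ <-]].
      by exists (gauss_curvature h c), c.
    by apply: cmin; rewrite inE.
  have [x _] := M_nonempty.
  rewrite leNgt; apply/negP => /(bound T p flow _ x).
  rewrite divr_ge0 ?expR_ge0 ?mulr_ge0// => /(_ isT).
  have -> : 2 * (C / (2 * K0)) * K0 = C by field; rewrite gt_eqF.
  by rewrite subrr leNgt expR_gt0.
split => //; rewrite fin_numElt (lt_le_trans _ T0) ?ltNyr//=.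
by rewrite (le_lt_trans Tle)// ltry.
Qed.
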